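(* Let $G$ be the (internal) Zappa-Szép product of two groups $H$ and $K$ with matched pair $(\sigma,\tau)$, and let $\mathcal{A}_c$ be the group of matrices defined in the context. Then there is an isomorphism of groups between $Aut_c(G)$ and $\mathcal{A}_c$ given by $\theta \longleftrightarrow \begin{pmatrix} \alpha & \beta\\ \gamma & \delta\end{pmatrix}$, where $\theta(h)=\alpha(h)\gamma(h)$ and $\theta(k)=\beta(k)\delta(k)$ for all $h\in H$ and $k\in K$ (with $\alpha(h),\beta(k)\in H$ and $\gamma(h),\delta(k)\in K$).
   Context: Zappa-Szép product: a group $G$ is the internal Zappa-Szép product of subgroups $H$ and $K$ if $G=HK$ and $H\cap K=\{1\}$. For $h\in H,k\in K$ write $kh=\sigma_k(h)\tau_h(k)$ with $\sigma_k(h)\in H$, $\tau_h(k)\in K$; this defines maps $\sigma:K\times H\to H$ and $\tau:K\times H\to K$ (the matched pair). They satisfy, for all $h,h'\in H$, $k,k'\in K$: $\sigma_1(h)=h$, $\tau_1(k)=k$; $\sigma_k(1)=1=\tau_h(1)$; $\sigma_{kk'}(h)=\sigma_k(\sigma_{k'}(h))$; $\tau_h(kk')=\tau_{\sigma_{k'}(h)}(k)\tau_h(k')$; $\sigma_k(hh')=\sigma_k(h)\sigma_{\tau_h(k)}(h')$; $\tau_{hh'}(k)=\tau_{h'}(\tau_h(k))$. Conversely, given groups $H,K$ and maps satisfying these conditions, $H\times K$ with $(h,k)(h',k')=(h\sigma_k(h'),\tau_{h'}(k)k')$ is a group (the external Zappa-Szép product), and it is identified with the internal one, $hk$ corresponding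 to $(h,k)$. Central automorphisms: $\theta\in Aut(G)$ is central if $g^{-1}\theta(g)\in Z(G)$ for all $g\in G$; $Aut_c(G)$ is the group of all central automorphisms of $G$ under composition. Notation: $Fix(\sigma)=\{h\in H\mid \sigma_k(h)=h \text{ for all } k\in K\}$; $Fix(\tau)=\{k\in K\mid \tau_h(k)=k\text{ for all }h\in H\}$; $i_g$ denotes the inner automorphism $x\mapsto gxg^{-1}$; $Map(U,V)$ is the set of all maps and $Hom(U,V)$ the set of all group homomorphisms from $U$ to $V$. For maps $\phi,\psi:U\to V$ of groups, $(\phi+\psi)(u)=\phi(u)\psi(u)$, and $\eta\phi$ denotes the composite $u\mapsto\eta(\phi(u))$. The group $\mathcal{A}_c$: the set of all matrices $\begin{pmatrix} \alpha & \beta\\ \gamma & \delta\end{pmatrix}$ with $\alpha\in Map(H,H)$, $\beta\in Hom(K,H)$, $\gamma\in Hom(H,K)$, $\delta\in Map(K,K)$ satisfying, for all $h,h'\in H$ and $k,k'\in K$: (A1) $\alpha(hh')=\alpha(h)\sigma_{\gamma(h)}(\alpha(h'))$; (A2) $h^{-1}\alpha(h)\in Fix(\sigma)$ and $\gamma(h)\in Fix(\tau)$; (A3) $\sigma_{\gamma(h)}=i_{(h^{-1}\alpha(h))^{-1}}$ (as maps on $H$) and $\tau_{h^{-1}\alpha(h)}=i_{\gamma(h)}$ (as maps on $K$); (A4) $\beta(k)\in Fix(\sigma)$ and $\tau_{\beta(k)}(k^{-1})\delta(k)\in Fix(\tau)$; (A5) $\sigma_{\tau_{\beta(k)}(k^{-1})\delta(k)}=i_{(\beta(k))^{-1}}$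 and $\tau_{\beta(k)}=i_{\tau_{\beta(k)}(k^{-1})\delta(k)}$; (A6) $h^{-1}\alpha(h)\beta(k)=\beta(k)h^{-1}\alpha(h)$ and $\gamma(h)\tau_{\beta(k)}(k^{-1})\delta(k)=\tau_{\beta(k)}(k^{-1})\delta(k)\gamma(h)$; (A7) $\delta(kk')=\tau_{\beta(k')}(\delta(k))\delta(k')$; (A8) $\beta(k)\sigma_{\delta(k)}(\alpha(h))=\alpha(\sigma_k(h))\beta(\tau_h(k))$; (A9) $\tau_{\alpha(h)}(\delta(k))\gamma(h)=\gamma(\sigma_k(h))\delta(\tau_h(k))$; (A10) for any $h'k'\in G$ (with $h'\in H$, $k'\in K$) there exist unique $h\in H$ and $k\in K$ such that $h'=\alpha(h)\beta(k)$ and $k'=\gamma(h)\delta(k)$. The set $\mathcal{A}_c$ forms a group under the operation $$\begin{pmatrix} \alpha' & \beta'\\ \gamma' & \delta'\end{pmatrix}\begin{pmatrix} \alpha & \beta\\ \gamma & \delta\end{pmatrix}=\begin{pmatrix} \alpha'\alpha+\beta'\gamma & \alpha'\beta+\beta'\delta\\ \gamma'\alpha+\delta'\gamma & \gamma'\beta+\delta'\delta\end{pmatrix}.$$ *)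

(* Defs.v *)
From mathcomp Require Import all_boot.
From mathcomp Require Import classical_sets functions.

Set Implicit Arguments.
Unset Strict Implicit.
Unset Printing Implicit Defensive.

Local Open Scope classical_set_scope.
Local Open Scope group_scope.

(** Groups presented as a subset [S] of an ambient type with a binary operation. *)
Definition group_on (T : Type) (S : set T) (op : T -> T -> T) : Prop :=
  [/\ forall x y, S x -> S y -> S (op x y),
      forall x y z, S x -> S y -> S z -> op x (op y z) = op (op x y) z
    & exists2 e, S e &
        forall x, S x ->
          [/\ op e x = x, op x e = x
            & exists y, [/\ S y, op y x = e & op x y = e]]].

Definition group_isomorphism (T U : Type) (S : set T) (opS : T -> T -> T)
    (S' : set U) (opS' : U -> U -> U) (f : T -> U) : Prop :=
  [/\ group_on S opS, group_on S' opS', set_bij S S' f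
    & forall x y, S x -> S y -> f (opS x y) = opS' (f x) (f y)].

Definition center (G : groupType) : set G :=
  [set z | forall g : G, commute z g].
Arguments center : clear implicits.

Definition inner (G : groupType) (g x : G) : G := g * x * g^-1.

Definition automorphism (G : groupType) (theta : G -> G) : Prop :=
  monoid_morphism theta /\ bijective theta.

Definition Aut_c (G : groupType) : set (G -> G) :=
  [set theta : G -> G | automorphism theta /\
     forall g : G, center G (g^-1 * theta g)].
Arguments Aut_c : clear implicits.

(** The subgroups [H] and [K] are subtypes of [G], with [val] as inclusion. *)
Definition zappa_szep (G : groupType) (SH SK : pred G)
    (H : subGroupType SH) (K : subGroupType SK) : Prop :=
  (forall g : G, exists (h : H) (k : K), g = val h * val k) /\
  (forall g : G, SH g -> SK g -> g = 1).

(** [sigma k h] is sigma_k(h) and [tau h k] is tau_h(k); in a Zappa-Szep product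
    this equation has exactly one solution [(sigma, tau)]. *)
Definition matched_pair (G : groupType) (SH SK : pred G)
    (H : subGroupType SH) (K : subGroupType SK)
    (sigma : K -> H -> H) (tau : H -> K -> K) : Prop :=
  forall (h : H) (k : K), val k * val h = val (sigma k h) * val (tau h k).

(** [Fix sigma] is a subset of [H] and [Fix tau] a subset of [K]. *)
Definition Fix (U V : Type) (act : U -> V -> V) : set V :=
  [set v | forall u, act u v = v].

Record map_matrix (H K : Type) := MapMatrix {
  mx_alpha : H -> H;
  mx_beta  : K -> H;
  mx_gamma : H -> K;
  mx_delta : K -> K }.

(** [mul_fun f g], the pointwise product of maps, is the sum [f + g] of the
    matrix calculus. *)
Definition map_matrix_mul (H K : groupType) (M' M : map_matrix H K) :
    map_matrix H K :=
  let: MapMatrix alpha' beta' gamma' delta' := M' in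
  let: MapMatrix alpha beta gamma delta := M in
  MapMatrix
    (mul_fun (alpha' \o alpha) (beta' \o gamma))
    (mul_fun (alpha' \o beta) (beta' \o delta))
    (mul_fun (gamma' \o alpha) (delta' \o gamma))
    (mul_fun (gamma' \o beta) (delta' \o delta)).

Section Ac.
Variables (H K : groupType) (sigma : K -> H -> H) (tau : H -> K -> K).
Variables (alpha : H -> H) (beta : K -> H) (gamma : H -> K) (delta : K -> K).

(** The H-part of h^-1 theta(h) and the K-part of k^-1 theta(k). *)
Let a (h : H) : H := h^-1 * alpha h.
Let d (k : K) : K := tau (beta k) k^-1 * delta k.

Definition A1 := forall h h' : H,
  alpha (h * h') = alpha h * sigma (gamma h) (alpha h').
Definition A2 := forall h : H, Fix sigma (a h) /\ Fix tau (gamma h).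
Definition A3 := forall h : H,
  sigma (gamma h) =1 inner (a h)^-1 /\ tau (a h) =1 inner (gamma h).
Definition A4 := forall k : K, Fix sigma (beta k) /\ Fix tau (d k).
Definition A5 := forall k : K,
  sigma (d k) =1 inner (beta k)^-1 /\ tau (beta k) =1 inner (d k).
Definition A6 := forall (h : H) (k : K),
  a h * beta k = beta k * a h /\ gamma h * d k = d k * gamma h.
Definition A7 := forall k k' : K,
  delta (k * k') = tau (beta k') (delta k) * delta k'.
Definition A8 := forall (h : H) (k : K),
  beta k * sigma (delta k) (alpha h) = alpha (sigma k h) * beta (tau h k).
Definition A9 := forall (h : H) (k : K),
  tau (alpha h) (delta k) * gamma h = gamma (sigma k h) * delta (tau h k).
Definition A10 := forall (h' : H) (k' : K),
  exists! hk : H * K,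
    h' = alpha hk.1 * beta hk.2 /\ k' = gamma hk.1 * delta hk.2.

Definition Ac_conditions : Prop :=
  [/\ monoid_morphism beta, monoid_morphism gamma
    & [/\ A1, A2, A3, A4 & A5] /\ [/\ A6, A7, A8, A9 & A10]].

End Ac.

Definition A_c (H K : groupType) (sigma : K -> H -> H) (tau : H -> K -> K) :
    set (map_matrix H K) :=
  [set M | Ac_conditions sigma tau
             (mx_alpha M) (mx_beta M) (mx_gamma M) (mx_delta M)].

Definition represents (G : groupType) (SH SK : pred G)
    (H : subGroupType SH) (K : subGroupType SK)
    (theta : G -> G) (M : map_matrix H K) : Prop :=
  (forall h : H, theta (val h) = val (mx_alpha M h) * val (mx_gamma M h)) /\
  (forall k : K, theta (val k) = val (mx_beta M k) * val (mx_delta M k)).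

(* Main.v *)
Require Import Defs.
From mathcomp Require Import all_boot.
From mathcomp Require Import classical_sets functions.
From mathcomp Require Import boolp.

(** Everything follows from uniqueness of the decomposition g = h k: an equation
    in [G] is the same as one equation in [H] and one in [K].

    An element a d of [G] commutes with all of [H] and all of [K] exactly when
    [a] and [d] are fixed points of the two actions and the actions of [d] on [H]
    and of [a] on [K] are the inner ones by [a^-1] and [d]
    ([center_decomposition]).  For a central automorphism [theta], applying this
    to the central elements h^-1 theta(h) and k^-1 theta(k) gives the conditions
    A2 to A5, and commutation of these two elements gives A6.  Writing out
    theta(h h'), theta(k k') and the two sides of theta(k h) =
    theta(sigma_k(h) tau_h(k)) gives A1, A7, A8 and A9, together with
    multiplicativity of [beta] and [gamma].  Since values of [beta] and [gamma]
    are fixed points, they commute with each other, so that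
    theta(h k) = (alpha(h) beta(k)) (gamma(h) delta(k)) ([represents_apply]), and
    A10 says that [theta] is bijective ([Aut_c_matrix]).

    Each of these steps can be read backwards: a matrix in [A_c] defines a map
    by the formula for theta(h k), which is then a central automorphism
    ([matrix_Aut_c]).  The same formula computes the matrix of a composite
    ([represents_comp]).  That [A_c] is a group comes for free, because it is the
    image of the group [Aut_c] under a map that respects the operations
    ([group_on_image]). *)

Set Implicit Arguments.
Unset Strict Implicit.
Unset Printing Implicit Defensive.

Local Open Scope classical_set_scope.
Local Open Scope group_scope.

(** * Groups and central automorphisms *)

Lemma group_on_image (T U : Type) (S : set T) (opS : T -> T -> T)
    (S' : set U) (opS' : U -> U -> U) (f : T -> U) :
  group_on S opS -> set_fun S S' f -> set_surj S S' f ->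
  (forall x y, S x -> S y -> f (opS x y) = opS' (f x) (f y)) ->
  group_on S' opS'.
Proof.
move=> [Scl SA [e Se Se1]] fS fsurj fM; split.
- move=> _ _ /fsurj[x Sx <-] /fsurj[y Sy <-].
  by rewrite -fM//; apply: fS; apply: Scl.
- move=> _ _ _ /fsurj[x Sx <-] /fsurj[y Sy <-] /fsurj[z Sz <-].
  have ? := Scl _ _ Sx Sy; have ? := Scl _ _ Sy Sz.
  by rewrite -!fM// SA.
- exists (f e); first exact: fS.
  move=> _ /fsurj[x Sx <-]; have [ex xe [y [Sy yx xy]]] := Se1 _ Sx.
  rewrite -!fM// ex xe; split=> //; exists (f y).
  by rewrite -!fM// yx xy; split=> //; apply: fS.
Qed.

Section CentralElements.
Variable G : groupType.

Lemma centerM (x y : G) : center G x -> center G y -> center G (x * y).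
Proof.
by move=> cx cy g; apply/commute_sym/commuteM; apply/commute_sym.
Qed.

Lemma centerV (x : G) : center G x -> center G x^-1.
Proof. by move=> cx g; apply/commute_sym/commuteV/commute_sym. Qed.

(** Centrality of g^-1 theta(g) thus has to be checked only on factors whose
    products exhaust the group. *)
Lemma displacementM (x y u v : G) : center G (x^-1 * u) ->
  (x * y)^-1 * (u * v) = (x^-1 * u) * (y^-1 * v).
Proof.
move=> cxu; rewrite invgM -mulgA mulgA mulgA -[_ * x^-1 * u]mulgA.
by rewrite -(cxu y^-1) -!mulgA.
Qed.

Lemma group_on_Aut_c : group_on (Aut_c G) (fun f g => f \o g).
Proof.
split=> //.
- move=> f g [[[f1 fM] fbij] fC] [[[g1 gM] gbij] gC]; split.
    split; last exact: bij_comp.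
    by split=> [|x y] /=; rewrite ?g1 ?f1// gM fM.
  (* x^-1 f(g x) = (x^-1 g x) ((g x)^-1 f(g x)) *)
  move=> x /=; rewrite -[x^-1](mulgK (g x)) -mulgA.
  exact: centerM.
- exists idfun.
    split=> [|x]; first by split=> //; exists idfun.
    by rewrite mulVg => g; exact/commute_sym/commute1.
  move=> f [[[f1 fM] [g fK gK]] fC]; split=> //; exists g; split.
  + split; first split.
    * by split=> [|x y]; apply: (can_inj fK); rewrite ?fM ?gK// f1.
    * by exists f.
    (* An automorphism reflects centrality, and f sends x^-1 g(x) to the inverse
       of the central element x^-1 f(x). *)
    * move=> x y; apply: (can_inj fK); rewrite !fM gK.
      suff -> : f x^-1 = (f x)^-1.
        by rewrite -[(f x)^-1 * x]invgK invgM invgK; exact: (centerV (fC x)).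
      by apply: (mulgI (f x)); rewrite -fM !mulgV.
  + by apply: funext => x /=; rewrite fK.
  + by apply: funext => x /=; rewrite gK.
Qed.

End CentralElements.

(** * Decompositions in a Zappa-Szep product *)

Section ZappaSzep.
Variables (G : groupType) (SH SK : pred G).
Variables (H : subGroupType SH) (K : subGroupType SK).
Variables (sigma : K -> H -> H) (tau : H -> K -> K).
Hypotheses (HK : zappa_szep H K) (st : matched_pair sigma tau).

Lemma decompositionI (h h' : H) (k k' : K) :
  val h * val k = val h' * val k' -> h = h' /\ k = k'.
Proof.
move=> e.
(* This element lies in both subgroups. *)
have e' : val (h'^-1 * h) = val (k' * k^-1).
  by rewrite !gmulfM !gmulfV; apply: (mulgI (val h'));
    rewrite mulVKg mulgA -e mulgK.
have h1 : val (h'^-1 * h) = 1.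
  by apply: HK.2; [exact: valP | rewrite e'; exact: valP].
have k1 : val (k' * k^-1) = 1 by rewrite -e'.
have {}h1 : h'^-1 * h = 1 by apply: val_inj; rewrite h1 gmulf1.
have {}k1 : k' * k^-1 = 1 by apply: val_inj; rewrite k1 gmulf1.
by split; [rewrite -[h](mulVKg h') h1 mulg1 | rewrite -[k'](mulgVK k) k1 mul1g].
Qed.

Lemma mul_decomposition (h h' : H) (k k' : K) :
  (val h * val k) * (val h' * val k') =
  val (h * sigma k h') * val (tau h' k * k').
Proof.
by rewrite !gmulfM -mulgA [val k * _]mulgA st -!mulgA.
Qed.

Lemma matched_pairM (k k' : K) (h : H) :
  sigma (k * k') h = sigma k (sigma k' h) /\
  tau h (k * k') = tau (sigma k' h) k * tau h k'.
Proof.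
by apply: decompositionI; rewrite -st !gmulfM -mulgA st mulgA st mulgA.
Qed.

Lemma matched_pair1 (h : H) (k : K) : sigma 1 h = h /\ tau 1 k = k.
Proof.
split; [apply: (proj1 (decompositionI (k := tau h 1) (k' := 1) _)) |
        apply: (proj2 (decompositionI (h := sigma k 1) (h' := 1) _))];
  by rewrite -st !gmulf1 mul1g mulg1.
Qed.

(** Needed because k^-1 beta(k) brings sigma_{k^-1}(beta(k)), instead of beta(k)
    itself, into the [H]-part of k^-1 theta(k). *)
Lemma sigmaVK (k : K) : cancel (sigma k^-1) (sigma k).
Proof.
by move=> h; rewrite -(matched_pairM _ _ _).1 mulgV (matched_pair1 _ 1).1.
Qed.

(** Commuting with [h] and with [k] amounts to the pairs of equations
    a sigma_d(h) = h a, tau_h(d) = d and sigma_k(a) = a, tau_a(k) d = d k. *)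
Lemma center_decomposition (a : H) (d : K) :
  center G (val a * val d) <->
  [/\ Fix sigma a, Fix tau d, sigma d =1 inner a^-1 & tau a =1 inner d].
Proof.
have cH h : (val a * val d) * val h = val (a * sigma d h) * val (tau h d).
  by rewrite -mulgA st mulgA gmulfM.
have cK k : val k * (val a * val d) = val (sigma k a) * val (tau a k * d).
  by rewrite mulgA st -mulgA gmulfM.
split=> [c|[sa td sd ta] g].
- have H1 h : a * sigma d h = h * a /\ tau h d = d.
    by apply: decompositionI; rewrite -cH c mulgA gmulfM.
  have K1 k : sigma k a = a /\ tau a k * d = d * k.
    by apply: decompositionI; rewrite -cK -c -mulgA gmulfM.
  split=> [k|h|h|k]; first by case: (K1 k).
  + by case: (H1 h).
  + by rewrite /inner invgK -mulgA -(proj1 (H1 h)) mulKg.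
  + by rewrite /inner -(proj2 (K1 k)) mulgK.
- have [h [k ->]] := HK.1 g; apply: commuteM.
  + by rewrite /commute cH sd td /inner invgK mulgA mulVKg mulgA gmulfM.
  + by rewrite /commute cK sa ta /inner mulgVK gmulfM -mulgA.
Qed.

(** * The matrix of a map *)

Section Represented.
Variables (theta : G -> G) (alpha : H -> H) (beta : K -> H).
Variables (gamma : H -> K) (delta : K -> K).
Let M := MapMatrix alpha beta gamma delta.
Hypothesis thM : represents theta M.

Lemma displacementH (h : H) :
  (val h)^-1 * theta (val h) = val (h^-1 * alpha h) * val (gamma h).
Proof. by rewrite thM.1 !gmulfM gmulfV mulgA. Qed.

Lemma displacementK (k : K) :
  (val k)^-1 * theta (val k) =
  val (sigma k^-1 (beta k)) * val (tau (beta k) k^-1 * delta k).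
Proof. by rewrite thM.2 gmulfM -gmulfV [RHS]mulgA -st mulgA. Qed.

(** The [H]-part sigma_{k^-1}(beta(k)) may be replaced by beta(k): as soon as one
    of the two is a fixed point of [sigma], they are equal. *)
Lemma center_displacementK (k : K) :
  center G ((val k)^-1 * theta (val k)) <->
  let d := tau (beta k) k^-1 * delta k in
  [/\ Fix sigma (beta k), Fix tau d, sigma d =1 inner (beta k)^-1
    & tau (beta k) =1 inner d].
Proof.
rewrite displacementK center_decomposition /=.
have Eb : Fix sigma (beta k) -> sigma k^-1 (beta k) = beta k by exact.
have Eb' : Fix sigma (sigma k^-1 (beta k)) -> sigma k^-1 (beta k) = beta k.
  by move=> /(_ k); rewrite sigmaVK.
by split=> [] [+ td]; [move=> /[dup] /Eb' -> | move=> /[dup] /Eb ->].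
Qed.

End Represented.

Lemma represents_matrix_unique (theta : G -> G) (M M' : map_matrix H K) :
  represents theta M -> represents theta M' -> M = M'.
Proof.
case: M M' => a b c d [a' b' c' d'] [/= th tk] [/= th' tk'].
have Eh h : a h = a' h /\ c h = c' h by apply: decompositionI; rewrite -th th'.
have Ek k : b k = b' k /\ d k = d' k by apply: decompositionI; rewrite -tk tk'.
by congr MapMatrix; apply: funext => x; (case: (Eh x) || case: (Ek x)).
Qed.

Lemma represents_map_unique (theta theta' : G -> G) (M : map_matrix H K) :
  {morph theta : x y / x * y} -> {morph theta' : x y / x * y} ->
  represents theta M -> represents theta' M -> theta = theta'.
Proof.
move=> tM tM' [th tk] [th' tk']; apply: funext => g.
by have [h [k ->]] := HK.1 g; rewrite tM tM' th th' tk tk'.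
Qed.

(** The two middle factors of (alpha(h) gamma(h)) (beta(k) delta(k)) can be
    exchanged because both are fixed points. *)
Lemma represents_apply (theta : G -> G) (M : map_matrix H K) :
  {morph theta : x y / x * y} -> represents theta M ->
  (forall k, Fix sigma (mx_beta M k)) -> (forall h, Fix tau (mx_gamma M h)) ->
  forall h k, theta (val h * val k) =
    val (mx_alpha M h * mx_beta M k) * val (mx_gamma M h * mx_delta M k).
Proof.
move=> tM [th tk] fb fg h k.
by rewrite tM th tk mul_decomposition fb fg.
Qed.

(** * From central automorphisms to matrices and back *)

Lemma Aut_c_matrix (theta : G -> G) (M : map_matrix H K) :
  Aut_c G theta -> represents theta M -> A_c sigma tau M.
Proof.
case: M => alpha beta gamma delta [[[t1 tM] tbij] tC] thM.
have [th tk] := thM; rewrite /= in th tk.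
have cH (h : H) := tC (val h); have cK (k : K) := tC (val k).
have zH h : [/\ Fix sigma (h^-1 * alpha h), Fix tau (gamma h),
    sigma (gamma h) =1 inner (h^-1 * alpha h)^-1
    & tau (h^-1 * alpha h) =1 inner (gamma h)].
  by apply/center_decomposition; rewrite -(displacementH thM).
have zK k := (center_displacementK thM k).1 (cK k); rewrite /= in zK.
have fg h : Fix tau (gamma h) by case: (zH h).
have fb k : Fix sigma (beta k) by case: (zK k).
have tHK := represents_apply tM thM fb fg; rewrite /= in tHK.
have mH h h' : alpha (h * h') = alpha h * sigma (gamma h) (alpha h') /\
    gamma (h * h') = gamma h * gamma h'.
  apply: decompositionI.
  by rewrite -th gmulfM tM !th mul_decomposition fg.
have mK k k' : beta (k * k') = beta k * beta k' /\
    delta (k * k') = tau (beta k') (delta k) * delta k'.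
  apply: decompositionI.
  by rewrite -tk gmulfM tM !tk mul_decomposition fb.
have mX h k :
    beta k * sigma (delta k) (alpha h) = alpha (sigma k h) * beta (tau h k) /\
    tau (alpha h) (delta k) * gamma h = gamma (sigma k h) * delta (tau h k).
  by apply: decompositionI; rewrite -tHK -st tM th tk mul_decomposition.
have idem (L : groupType) (x : L) : x = x * x -> x = 1.
  by move=> e; apply: (mulgI x); rewrite -e mulg1.
split.
- split=> [|k k']; last exact: (mK k k').1.
  by apply: idem; rewrite -(mK 1 1).1 mulg1.
- split=> [|h h']; last exact: (mH h h').2.
  by apply: idem; rewrite -(mH 1 1).2 mulg1.
split; split.
- by move=> h h'; case: (mH h h').
- by move=> h; case: (zH h).
- by move=> h; case: (zH h).
- by move=> k; case: (zK k).
- by move=> k; case: (zK k).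
- move=> h k; apply: decompositionI.
  (* As a gamma(h) is central, it commutes with beta(k) d, and fixed points of
     sigma commute with fixed points of tau. *)
  have [sa _ _ _] := zH h; have [sb sd _ _] := zK k.
  set a := h^-1 * alpha h; set d := tau (beta k) k^-1 * delta k.
  have zag : center G (val a * val (gamma h)).
    by rewrite -(displacementH thM).
  have := zag (val (beta k) * val d).
  by rewrite /commute !mul_decomposition sa sb sd fg.
- by move=> k k'; case: (mK k k').
- by move=> h k; case: (mX h k).
- by move=> h k; case: (mX h k).
- move=> h' k'; have [eta tK eK] := tbij.
  have [h [k e]] := HK.1 (eta (val h' * val k')).
  exists (h, k); split=> [/=|[h1 k1] /= [e1 e2]].
    by apply: decompositionI; rewrite -tHK -e eK.
  have [-> ->] // : h = h1 /\ k = k1.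
  by apply: decompositionI; rewrite -e e1 e2 -tHK tK.
Qed.

(** The candidate [theta] sends h k to A(h) B(k), where A(h) = alpha(h) gamma(h)
    and B(k) = beta(k) delta(k).  It is multiplicative because [A] and [B] are,
    by A1 and A7, and because B(k) A(h) = A(sigma_k(h)) B(tau_h(k)), by A8 and
    A9: these are the relations which define the multiplication of [G]. *)
Lemma matrix_Aut_c (M : map_matrix H K) : A_c sigma tau M ->
  exists2 theta, Aut_c G theta & represents theta M.
Proof.
case: M => alpha beta gamma delta.
case=> [[/= b1 bM] [/= g1 gM] [[a1 a2 a3 a4 a5] [_ a7 a8 a9 a10]]].
have fg h : Fix tau (gamma h) by case: (a2 h).
have fb k : Fix sigma (beta k) by case: (a4 k).
have [A AE] : exists A, forall h, A h = val (alpha h) * val (gamma h).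
  by eexists.
have [B BE] : exists B, forall k, B k = val (beta k) * val (delta k).
  by eexists.
have AM h h' : A (h * h') = A h * A h'.
  by rewrite !AE mul_decomposition fg a1 gM.
have BM k k' : B (k * k') = B k * B k'.
  by rewrite !BE mul_decomposition fb a7 bM.
have BA k h : B k * A h = A (sigma k h) * B (tau h k).
  by rewrite !(AE, BE) !mul_decomposition fg fb a8 a9.
have A_1 : A 1 = 1 by apply: (mulgI (A 1)); rewrite -AM !mulg1.
have B_1 : B 1 = 1 by apply: (mulgI (B 1)); rewrite -BM !mulg1.
have AB_split h k :
    A h * B k = val (alpha h * beta k) * val (gamma h * delta k).
  by rewrite !(AE, BE) mul_decomposition fg fb.
have /choice[f fE] : forall g : G, exists p : H * K, g = val p.1 * val p.2.
  by move=> g; have [h [k ->]] := HK.1 g; exists (h, k).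
pose theta g := A (f g).1 * B (f g).2.
have tE h k : theta (val h * val k) = A h * B k.
  rewrite /theta; set g := val h * val k.
  by have [<- <-] := decompositionI (fE g).
have tH h : theta (val h) = A h.
  by rewrite -[val h]mulg1 -(gmulf1 (s := val : K -> G)) tE B_1 mulg1.
have tK k : theta (val k) = B k.
  by rewrite -[val k]mul1g -(gmulf1 (s := val : H -> G)) tE A_1 mul1g.
have tM : {morph theta : x y / x * y}.
  move=> x y; rewrite (fE x) (fE y) mul_decomposition !tE AM BM -!mulgA.
  by congr (_ * _); rewrite [RHS]mulgA BA -mulgA.
have thM : represents theta (MapMatrix alpha beta gamma delta).
  by split=> x; rewrite /= (tH, tK) (AE, BE).
have /choice[eta etaK] : forall g, exists x, theta x = g.
  move=> g; have [[h k] /= [[eh ek] _]] := a10 (f g).1 (f g).2.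
  by exists (val h * val k); rewrite tE AB_split -eh -ek -fE.
have tI : injective theta.
  move=> x y; rewrite (fE x) (fE y) !tE !AB_split => /decompositionI[eh ek].
  have [hk [_ uniq]] :=
    a10 (alpha (f x).1 * beta (f x).2) (gamma (f x).1 * delta (f x).2).
  by rewrite -(uniq (f x)) // -(uniq (f y)).
exists theta => //; split; first split.
- by split=> //; have := tH 1; rewrite A_1 gmulf1.
- by exists eta => // x; apply: tI; rewrite etaK.
move=> g; rewrite (fE g) tM.
have cH : center G ((val (f g).1)^-1 * theta (val (f g).1)).
  rewrite (displacementH thM); apply/center_decomposition.
  by have [? ?] := a2 (f g).1; have [? ?] := a3 (f g).1.
rewrite displacementM//; apply: centerM => //.
apply/(center_displacementK thM) => /=.
by have [? ?] := a4 (f g).2; have [? ?] := a5 (f g).2.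
Qed.

(** The image theta(h) = alpha(h) gamma(h) is itself decomposed, so [theta']
    applies to it by [represents_apply]. *)
Lemma represents_comp (theta' theta : G -> G) (M' M : map_matrix H K) :
  {morph theta' : x y / x * y} -> A_c sigma tau M' ->
  represents theta' M' -> represents theta M ->
  represents (theta' \o theta) (map_matrix_mul M' M).
Proof.
move=> tM [_ _ [[_ A2 _ A4 _] _]] thM' [th tk].
have tE := represents_apply tM thM' (fun k => (A4 k).1) (fun h => (A2 h).2).
case: M' M tE th tk {A2 A4 thM'} => a' b' c' d' [a b c d] /= tE th tk.
by split=> x /=; rewrite (th, tk) tE.
Qed.

End ZappaSzep.

Theorem theorem2p2 (G : groupType) (SH SK : pred G)
    (H : subGroupType SH) (K : subGroupType SK)
    (sigma : K -> H -> H) (tau : H -> K -> K)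
    (HK : zappa_szep H K) (st : matched_pair sigma tau) :
  exists Phi : (G -> G) -> map_matrix H K,
    group_isomorphism
      (Aut_c G) (fun theta' theta => theta' \o theta)
      (A_c sigma tau) (@map_matrix_mul H K) Phi /\
    (forall theta : G -> G, Aut_c G theta -> represents theta (Phi theta)).
Proof.
have /choice[f fE] : forall g : G, exists p : H * K, g = val p.1 * val p.2.
  by move=> g; have [h [k ->]] := HK.1 g; exists (h, k).
pose Phi (theta : G -> G) := MapMatrix
  (fun h : H => (f (theta (val h))).1) (fun k : K => (f (theta (val k))).1)
  (fun h : H => (f (theta (val h))).2) (fun k : K => (f (theta (val k))).2).
have PhiE theta : represents theta (Phi theta) by split=> x; apply: fE.
have PhiA theta : Aut_c G theta -> A_c sigma tau (Phi theta).
  by move=> ct; apply: (Aut_c_matrix HK st ct).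
have morph theta : Aut_c G theta -> {morph theta : x y / x * y}.
  by case=> [[[]]].
have PhiS : set_surj (Aut_c G) (A_c sigma tau) Phi.
  move=> M /(matrix_Aut_c HK st)[theta ct tM]; exists theta => //.
  exact: represents_matrix_unique (PhiE theta) tM.
have PhiM theta' theta : Aut_c G theta' -> Aut_c G theta ->
    Phi (theta' \o theta) = map_matrix_mul (Phi theta') (Phi theta).
  move=> ct' ct; apply: (represents_matrix_unique HK (PhiE _)).
  have ac' := PhiA _ ct'; have mt' := morph _ ct'.
  exact (represents_comp st mt' ac' (PhiE theta') (PhiE theta)).
exists Phi; split=> [|theta _]; last exact: PhiE.
split=> //; first exact: group_on_Aut_c.
- exact: group_on_image (group_on_Aut_c G) PhiA PhiS PhiM.
- split=> // theta theta' /set_mem ct /set_mem ct' e.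
  apply: (represents_map_unique HK (morph _ ct) (morph _ ct') (PhiE theta)).
  by rewrite e; exact: PhiE.
Qed.
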